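(* Let $R=R_1\times R_2\times\cdots\times R_s$, where each $R_i$ is a finite local ring with maximal ideal $M_i$ of order $m_i$, and where $|R_1|/m_1\le\cdots\le |R_s|/m_s$. Then for every integer $k\ge 1$, $$s_k(G_R)=|R^\times|\prod_{i=1}^s\left(|R_i^\times|^{k-1}-(-m_i)^{k-1}\right),$$ $$s_k(\mathcal{L}(G_R))=\left(\sum_{j=0}^k\binom{k}{j}(|R^\times|-2)^{k-j}s_j(G_R)\right)-(-2)^{k-1}|R|(|R^\times|-2).$$
   Context: Rings are commutative with identity $1\neq 0$. For a finite commutative ring $R$, $R^\times$ denotes its group of units. The unitary Cayley graph $G_R$ is the graph with vertex set $R$ in which $x,y\in R$ are adjacent iff $x-y\in R^\times$. A local ring is a commutative ring with a unique maximal ideal. The line graph $\mathcal{L}(G)$ of a graph $G$ has the edges of $G$ as vertices, two being adjacent iff they share an end-vertex. For a graph $G$ with $n$ vertices and adjacency eigenvalues $\lambda_1,\ldots,\lambda_n$, its $k$-th spectral moment is $s_k(G)=\sum_{i=1}^n\lambda_i^k$ for integers $k\ge 0$ (so $s_0(G)=n$). *)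

(* Defs.v *)
From HB Require Import structures.
From mathcomp Require Import all_boot all_order all_fingroup all_algebra all_field.
From mathcomp Require Import ring_quotient.

Set Implicit Arguments.
Unset Strict Implicit.
Unset Printing Implicit Defensive.

Import GRing.Theory.
Local Open Scope ring_scope.

(* The library's [idealr_closed] already includes properness (1 is not in the
   ideal), so maximality only has to be tested against [idealr_closed] sets. *)
Definition maximal_ideal (R : finComUnitRingType) (M : {set R}) : Prop :=
  idealr_closed M /\
  forall J : {set R}, idealr_closed J -> M \subset J -> J = M.

Definition local_ring_with (R : finComUnitRingType) (M : {set R}) : Prop :=
  maximal_ideal M /\ forall N : {set R}, maximal_ideal N -> N = M.

(* The index type is 'I_n.+1 because the empty product would be the zero ring. *)
Definition prod_ring (n : nat) (R : 'I_n.+1 -> finComUnitRingType) : Type :=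
  {dffun forall i : 'I_n.+1, R i}.

Section ProdRing.
Variables (n : nat) (R : 'I_n.+1 -> finComUnitRingType).
Implicit Types f g h : prod_ring R.

HB.instance Definition _ := Finite.on (prod_ring R).

Definition prod_zero : prod_ring R := [ffun i => 0 : R i].
Definition prod_one : prod_ring R := [ffun i => 1 : R i].
Definition prod_opp f : prod_ring R := [ffun i => - f i : R i].
Definition prod_add f g : prod_ring R := [ffun i => f i + g i : R i].
Definition prod_mul f g : prod_ring R := [ffun i => f i * g i : R i].

Fact prod_addA : associative prod_add.
Proof. by move=> f g h; apply/ffunP=> i; rewrite !ffunE addrA. Qed.
Fact prod_addC : commutative prod_add.
Proof. by move=> f g; apply/ffunP=> i; rewrite !ffunE addrC. Qed.
Fact prod_add0 : left_id prod_zero prod_add.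
Proof. by move=> f; apply/ffunP=> i; rewrite !ffunE add0r. Qed.
Fact prod_addN : left_inverse prod_zero prod_opp prod_add.
Proof. by move=> f; apply/ffunP=> i; rewrite !ffunE addNr. Qed.

HB.instance Definition _ := GRing.isZmodule.Build (prod_ring R)
  prod_addA prod_addC prod_add0 prod_addN.

Fact prod_mulA : associative prod_mul.
Proof. by move=> f g h; apply/ffunP=> i; rewrite !ffunE mulrA. Qed.
Fact prod_mulC : commutative prod_mul.
Proof. by move=> f g; apply/ffunP=> i; rewrite !ffunE mulrC. Qed.
Fact prod_mul1 : left_id prod_one prod_mul.
Proof. by move=> f; apply/ffunP=> i; rewrite !ffunE mul1r. Qed.
Fact prod_mulDl : left_distributive prod_mul +%R.
Proof. by move=> f g h; apply/ffunP=> i; rewrite !ffunE mulrDl. Qed.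
Fact prod_one_neq0 : prod_one != 0.
Proof. by apply/eqP=> /ffunP/(_ ord0)/eqP; rewrite !ffunE oner_eq0. Qed.

HB.instance Definition _ := GRing.Zmodule_isComNzRing.Build (prod_ring R)
  prod_mulA prod_mulC prod_mul1 prod_mulDl prod_one_neq0.

Definition prod_unit : pred (prod_ring R) :=
  fun f => [forall i, f i \is a GRing.unit].
Definition prod_inv f : prod_ring R :=
  if prod_unit f then [ffun i => (f i)^-1 : R i] else f.

Fact prod_mulV : {in prod_unit, left_inverse 1 prod_inv *%R}.
Proof.
move=> f; rewrite -topredE /= /prod_inv => Uf; rewrite Uf.
by apply/ffunP=> i; rewrite !ffunE mulVr //; apply/(forallP Uf).
Qed.
Fact prod_unitP f g : g * f = 1 -> prod_unit f.
Proof.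
move=> /ffunP gf1; apply/forallP=> i; apply/unitrPr; exists (g i).
by have := gf1 i; rewrite !ffunE mulrC.
Qed.
Fact prod_inv_out : {in [predC prod_unit], prod_inv =1 id}.
Proof. by move=> f; rewrite inE /= /prod_inv -topredE /= => /negPf ->. Qed.

HB.instance Definition _ := GRing.ComNzRing_hasMulInverse.Build (prod_ring R)
  prod_mulV prod_unitP prod_inv_out.

End ProdRing.

Record sgraph := SGraph {
  vertex :> finType;
  adj : rel vertex;
  adj_sym : symmetric adj;
  adj_irr : irreflexive adj }.

Section UnitaryCayley.
Variable R : finComUnitRingType.

Definition unitary_adj : rel R := fun x y => (x - y) \is a GRing.unit.

Fact unitary_adj_sym : symmetric unitary_adj.
Proof. by move=> x y; rewrite /unitary_adj -opprB unitrN. Qed.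
Fact unitary_adj_irr : irreflexive unitary_adj.
Proof. by move=> x; rewrite /unitary_adj subrr unitr0. Qed.

Definition unitary_cayley : sgraph := SGraph unitary_adj_sym unitary_adj_irr.

End UnitaryCayley.

Section LineGraph.
Variable G : sgraph.

Definition is_edge (A : {set G}) : bool :=
  [exists x : G, exists y : G, adj x y && (A == [set x; y])].

Definition edge : finType := {A : {set G} | is_edge A}.

Definition line_adj : rel edge :=
  fun A B => (A != B) && (val A :&: val B != set0).

Fact line_adj_sym : symmetric line_adj.
Proof. by move=> A B; rewrite /line_adj eq_sym setIC. Qed.
Fact line_adj_irr : irreflexive line_adj.
Proof. by move=> A; rewrite /line_adj eqxx. Qed.

Definition line_graph : sgraph := SGraph line_adj_sym line_adj_irr.

End LineGraph.

Definition adjmx (G : sgraph) : 'M[algC]_#|G| :=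
  \matrix_(i, j) (adj (enum_val i) (enum_val j))%:R.

(* Eigenvalues with algebraic multiplicity: the list of roots of the (monic)
   characteristic polynomial. *)
Definition eigenvalues (m : nat) (A : 'M[algC]_m) : seq algC :=
  sval (closed_field_poly_normal (char_poly A)).

Lemma eigenvaluesP (m : nat) (A : 'M[algC]_m) :
  char_poly A = \prod_(z <- eigenvalues A) ('X - z%:P).
Proof.
rewrite /eigenvalues; case: closed_field_poly_normal => r /= ->.
by rewrite (monicP (char_poly_monic A)) scale1r.
Qed.

Definition spectral_moment (k : nat) (G : sgraph) : algC :=
  \sum_(z <- eigenvalues (adjmx G)) z ^+ k.

Definition nunits (R : finComUnitRingType) : nat := #|[set: {unit R}]|.

(* Main.v *)
Require Import Defs.
From HB Require Import structures.
From mathcomp Require Import all_boot all_order all_fingroup all_algebra all_field.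
From mathcomp Require Import ring_quotient.
From mathcomp Require Import ring.

Set Implicit Arguments.
Unset Strict Implicit.
Unset Printing Implicit Defensive.

Import GRing.Theory Num.Theory.
Local Open Scope ring_scope.

(** Adjacency matrices are real symmetric, hence diagonalisable, so the k-th
    spectral moment is the trace of the k-th power. Adjacency in the unitary
    Cayley graph of a product ring is the product of the adjacencies, so this
    trace is multiplicative, and for a local ring the adjacency matrix is J - E
    with E the block matrix of the cosets of the maximal ideal. For the line
    graph of an r-regular graph with incidence matrix B, we have
    B B^T = A + r and B^T B = A_L + 2; the powers of these two products have
    equal traces, except for the exponent 0. *)

(** * Spectral moments as traces of powers *)

Lemma char_poly_conj (F : fieldType) n (P A : 'M[F]_n) :
  P \in unitmx -> char_poly (invmx P *m A *m P) = char_poly A.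
Proof.
move=> Pu; rewrite /char_poly.
have -> : char_poly_mx (invmx P *m A *m P) =
    map_mx polyC (invmx P) *m char_poly_mx A *m map_mx polyC P.
  rewrite /char_poly_mx mulmxBr mulmxBl !map_mxM mul_mx_scalar -scalemxAl.
  by rewrite -[X in _ = _ *: X - _]map_mxM mulVmx // map_mx1 scalemx1.
rewrite !det_mulmx mulrAC mulrC -det_mulmx -map_mxM mulVmx //.
by rewrite map_mx1 det1 mulr1.
Qed.

Lemma expr_diag_mx (F : fieldType) n (d : 'rV[F]_n) k :
  diag_mx d ^+ k = diag_mx (\row_j d 0 j ^+ k).
Proof.
elim: k => [|k IHk].
  by rewrite expr0; apply/matrixP=> i j; rewrite !mxE expr0.
rewrite exprS IHk -[_ * _]/(_ *m _) mulmx_diag; congr diag_mx.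
by apply/rowP=> j; rewrite !mxE exprS.
Qed.

Lemma expr_conj_mx (F : fieldType) n (P A : 'M[F]_n) k :
  P \in unitmx -> (invmx P *m A *m P) ^+ k = invmx P *m A ^+ k *m P.
Proof.
move=> Pu; elim: k => [|k IHk]; first by rewrite !expr0 mulmx1 mulVmx.
by rewrite !exprS IHk -[_ * _]/(_ *m _) -[A * _]/(A *m _) !mulmxA mulmxK.
Qed.

(** The spectral theorem conjugates [A] to a diagonal matrix. Its diagonal and [eigenvalues A] list
    the roots of the same characteristic polynomial, so they agree up to order. *)
Lemma sum_eigenvalues_exp n (A : 'M[algC]_n) k :
  A \is normalmx -> \sum_(z <- eigenvalues A) z ^+ k = \tr (A ^+ k).
Proof.
move=> /orthomx_spectralP; set P := spectralmx A; set d := spectral_diag A.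
move=> defA; have Pu : P \in unitmx by apply: spectral_unit.
have eq_chi : char_poly A = \prod_(z <- [seq d 0 i | i <- enum 'I_n]) ('X - z%:P).
  rewrite defA char_poly_conj // char_poly_trig ?diag_mx_is_trig //.
  rewrite big_map -big_enum; apply: eq_bigr => i _.
  by rewrite mxE eqxx.
have eq_ev : perm_eq (eigenvalues A) [seq d 0 i | i <- enum 'I_n].
  by apply/prod_XsubC_eq; rewrite -eq_chi eigenvaluesP.
rewrite (perm_big _ eq_ev) big_map big_enum defA expr_conj_mx //.
rewrite mxtrace_mulC mulmxA mulmxV // mul1mx expr_diag_mx mxtrace_diag.
by apply: eq_bigr => i _; rewrite mxE.
Qed.

Lemma adjmx_normal (G : sgraph) : adjmx G \is normalmx.
Proof.
apply/normalmxP; suff -> : (adjmx G ^t Num.conj)%sesqui = adjmx G by [].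
by apply/matrixP=> i j; rewrite !mxE adj_sym conjC_nat.
Qed.

Lemma spectral_moment_trace k (G : sgraph) :
  spectral_moment k G = \tr (adjmx G ^+ k).
Proof. exact/sum_eigenvalues_exp/adjmx_normal. Qed.

(** Powers of a matrix indexed by the finite type itself instead of ordinals, so that products of
    types need no renumbering of indices. *)
Fixpoint kernel_exp (T : finType) (a : T -> T -> algC) k (x y : T) : algC :=
  if k is k'.+1 then \sum_z a x z * kernel_exp a k' z y else (x == y)%:R.

Lemma kernel_exp1 (T : finType) (a : T -> T -> algC) x y :
  kernel_exp a 1 x y = a x y.
Proof.
rewrite /= (bigD1 y) //= eqxx mulr1 big1 ?addr0 // => z /negPf->.
by rewrite mulr0.
Qed.

Lemma eq_kernel_exp (T : finType) (a b : T -> T -> algC) k :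
  a =2 b -> kernel_exp a k =2 kernel_exp b k.
Proof.
move=> eq_ab; elim: k => //= k IHk x y.
by apply: eq_bigr => z _; rewrite eq_ab IHk.
Qed.

Lemma spectral_moment_kernel k (G : sgraph) :
  spectral_moment k G =
  \sum_(x : G) kernel_exp (fun x y => (adj x y)%:R) k x x.
Proof.
rewrite spectral_moment_trace /mxtrace.
suff expE i j : (adjmx G ^+ k) i j =
    kernel_exp (fun x y => (adj x y)%:R) k (enum_val i) (enum_val j).
  rewrite (big_enum_val (fun x => kernel_exp _ k x x)).
  by apply: eq_bigr => i _; rewrite expE.
elim: k i j => [|k IHk] i j.
  by rewrite expr0 mxE /= (inj_eq enum_val_inj).
rewrite exprS mxE /= (big_enum_val (fun z => _ * kernel_exp _ k z _)).
by apply: eq_bigr => l _; rewrite IHk mxE.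
Qed.

(** * Kernels on finite products *)

Lemma sum_prod_dffun (R : comPzSemiRingType) (I : finType) (T : I -> finType)
    (F : forall i, T i -> R) :
  \sum_(f : {dffun forall i, T i}) \prod_i F i (f i) =
  \prod_i \sum_(x : T i) F i x.
Proof.
rewrite (reindex (@dffun_of_fprod I T)); last first.
  exact/onW_bij/dffun_of_fprod_bij.
pose P i := [ffun x => F i x].
transitivity (\sum_(t : fprod T) \prod_(i in I) P i (t i)).
  by apply: eq_bigr => t _; apply: eq_bigr => i _; rewrite !ffunE.
rewrite big_fprod.
(* The choices for all [i] become functions into one tagged sum type, where ordinary distributivity
   applies. Only elements with tag [i] are summed, so the default [0] of [untag] is never
   reached. *)
transitivity (\prod_i \sum_(j in tagged_with T i) untag 0 (P i) j).
  by rewrite bigA_distr_big_dep.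
apply: eq_bigr => i _; rewrite -(big_tag (fun i x => P i x)).
by apply: eq_bigr => x _; rewrite ffunE.
Qed.

Lemma prodr_bool (R : comPzSemiRingType) (I : finType) (P : pred I) :
  \prod_i (P i)%:R = [forall i, P i]%:R :> R.
Proof.
case: forallP => [allP | nP]; first by rewrite big1 // => i _; rewrite allP.
have [i /negPf nPi | allP] := pickP (fun i => ~~ P i).
  by rewrite (bigD1 i) //= nPi mul0r.
by case: nP => i; have := allP i; case: (P i).
Qed.

(** Powers of a Kronecker product are Kronecker products of powers: in each induction step the sum
    over the intermediate point factors by coordinates. *)
Lemma kernel_exp_prod (I : finType) (T : I -> finType)
    (a : forall i, T i -> T i -> algC) k (f g : {dffun forall i, T i}) :
  kernel_exp (fun f g : {dffun forall i, T i} => \prod_i a i (f i) (g i)) k f g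
  = \prod_i kernel_exp (a i) k (f i) (g i).
Proof.
elim: k f g => [|k IHk] f g /=.
  rewrite prodr_bool; congr (nat_of_bool _)%:R.
  apply/eqP/forallP => [-> // | eq_fg]; apply/ffunP=> i; exact/eqP.
rewrite -(sum_prod_dffun (fun i z => a i (f i) z * kernel_exp (a i) k z (g i))).
by apply: eq_bigr => h _; rewrite IHk -big_split.
Qed.

(** * Unitary Cayley graphs of product rings *)

Lemma sum_unitr (R : finComUnitRingType) :
  \sum_(x : R) (x \is a GRing.unit)%:R = (nunits R)%:R :> algC.
Proof.
by rewrite -natr_sum -big_mkcond sum1_card /nunits cardsT card_sub.
Qed.

Lemma unitr_prod_ring n (Rs : 'I_n.+1 -> finComUnitRingType) (f : prod_ring Rs) :
  (f \is a GRing.unit) = [forall i, f i \is a GRing.unit].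
Proof. by []. Qed.

Lemma nunits_prod_ring n (Rs : 'I_n.+1 -> finComUnitRingType) :
  (nunits (prod_ring Rs))%:R = \prod_i (nunits (Rs i))%:R :> algC.
Proof.
rewrite -sum_unitr; under [RHS]eq_bigr do rewrite -sum_unitr.
rewrite -sum_prod_dffun; apply: eq_bigr => f _.
by rewrite prodr_bool.
Qed.

Lemma spectral_moment_prod_ring n (Rs : 'I_n.+1 -> finComUnitRingType) k :
  spectral_moment k (unitary_cayley (prod_ring Rs)) =
  \prod_i spectral_moment k (unitary_cayley (Rs i)).
Proof.
rewrite spectral_moment_kernel.
under [RHS]eq_bigr do rewrite spectral_moment_kernel.
rewrite -sum_prod_dffun; apply: eq_bigr => f _.
rewrite -kernel_exp_prod; apply: eq_kernel_exp => g h.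
rewrite prodr_bool /= /unitary_adj unitr_prod_ring; congr (nat_of_bool _)%:R.
by apply: eq_forallb => i; rewrite !ffunE.
Qed.

(** * Unitary Cayley graphs of local rings *)

Section LocalRing.
Variables (R : finComUnitRingType) (M : {set R}).
Hypothesis locM : local_ring_with M.

(** A unit in [M] would put 1 in [M]. Conversely, a nonunit generates a proper ideal; a maximal
    ideal above it must be [M] by uniqueness. *)
Lemma local_ring_nonunits x : (x \in M) = (x \isn't a GRing.unit).
Proof.
case: locM => [[[M0 M1 MD] _] uniqM]; apply/idP/idP => [Mx | nUx].
  apply: contra M1 => Ux.
  by rewrite -(mulVr Ux) -[_ * _]addr0 MD.
(* A boolean form of [idealr_closed], so that finiteness yields a maximal set above the principal
   ideal of [x]. *)
pose idealb (J : {set R}) := [&& 0 \in J, 1 \notin J &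
  [forall a, forall u in J, forall v in J, a * u + v \in J]].
have idealP (J : {set R}) : reflect (idealr_closed J) (idealb J).
  apply: (iffP and3P) => -[J0 J1 JD]; split=> //.
    by move=> a u v Ju Jv; move/forallP/(_ a)/forall_inP/(_ u Ju)/forall_inP: JD; apply.
  by apply/forallP=> a; do 2!apply/forall_inP=> ? ?; apply: JD.
have idx : idealb [set a * x | a in R].
  apply/idealP; split.
  - by apply/imsetP; exists 0; rewrite ?mul0r.
  - apply/imsetP=> -[a _ /esym ax1]; case/negP: nUx; apply/unitrP; exists a.
    by rewrite (mulrC x) ax1.
  - move=> a _ _ /imsetP[b _ ->] /imsetP[c _ ->]; apply/imsetP.
    by exists (a * b + c); rewrite // mulrDl mulrA.
have [N /maxsetP[/idealP idN maxN] /subsetP xN] := maxset_exists idx.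
have <- : N = M by apply: uniqM; split=> // J /idealP; apply: maxN.
by apply: xN; apply/imsetP; exists 1; rewrite ?mul1r.
Qed.

Lemma local_ring_card : #|R|%:R = (nunits R)%:R + #|M|%:R :> algC.
Proof.
rewrite -sum_unitr -!sum1_card !natr_sum [X in _ + X]big_mkcond -big_split /=.
by apply: eq_bigr => x _; rewrite local_ring_nonunits; case: ifP => /negPf;
  case: (x \is a _); rewrite ?addr0 ?add0r.
Qed.

Lemma local_ringD x y : x \in M -> y \in M -> x + y \in M.
Proof.
by case: locM => [[[_ _ MD] _] _] Mx My; rewrite -[x]mul1r MD.
Qed.

Lemma local_ringN x : (- x \in M) = (x \in M).
Proof. by rewrite !local_ring_nonunits unitrN. Qed.

Lemma sum_coset (x : R) : \sum_z (x - z \in M)%:R = #|M|%:R :> algC.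
Proof.
rewrite -sum1_card natr_sum [RHS]big_mkcond (reindex_inj (inv_inj (subKr x))).
by apply: eq_bigr => z _; rewrite subKr; case: ifP.
Qed.

(** This is E^2 = |M| E for the coset matrix E: once x - z lies in [M], z - y lies in [M] exactly
    when x - y does. *)
Lemma sum_coset2 (x y : R) :
  \sum_z (x - z \in M)%:R * (z - y \in M)%:R =
  #|M|%:R * (x - y \in M)%:R :> algC.
Proof.
rewrite -(sum_coset x) mulr_suml; apply: eq_bigr => z _.
case Mxz: (x - z \in M); rewrite ?mul0r // !mul1r; congr (nat_of_bool _)%:R.
apply/idP/idP => [Mzy | Mxy]; first by rewrite -(subrKA z) local_ringD.
by rewrite -(subrKA x) local_ringD // -opprB local_ringN.
Qed.

(* With E the block matrix of the cosets of M and J the all-ones matrix, the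
   adjacency matrix is J - E, whose powers stay in the span of J and E. *)
Lemma kernel_exp_local k (x y : R) :
  kernel_exp (fun x y : R => (unitary_adj x y)%:R) k.+1 x y =
  ((nunits R)%:R ^+ k.+1 - (- #|M|%:R) ^+ k.+1) / #|R|%:R
    - (- #|M|%:R) ^+ k * (x - y \in M)%:R.
Proof.
have adjE (u v : R) : (unitary_adj u v)%:R = 1 - (u - v \in M)%:R :> algC.
  rewrite local_ring_nonunits /unitary_adj.
  by case: (_ \is a _); rewrite ?subr0 ?subrr.
have N0 : (nunits R)%:R + #|M|%:R != 0 :> algC.
  by rewrite -local_ring_card pnatr_eq0 -lt0n; apply/card_gt0P; exists 0.
have NE := local_ring_card.
elim: k x y => [|k IHk] x y.
  rewrite kernel_exp1 adjE NE !expr1 expr0 mul1r opprK divff //.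
rewrite [LHS](_ : _ = \sum_z (unitary_adj x z)%:R *
  kernel_exp (fun x y : R => (unitary_adj x y)%:R) k.+1 z y) //.
set r := (nunits R)%:R in NE N0 *; set m := #|M|%:R in NE N0 *.
under eq_bigr do rewrite IHk adjE.
set al := _ / _; set be := _ ^+ k.
(* Expands (J - E)(al J - be E), entry by entry, into its J^2, JE, EJ and E^2 terms. *)
transitivity (\sum_(z : R) (al - be * (z - y \in M)%:R - al * (x - z \in M)%:R
    + be * ((x - z \in M)%:R * (z - y \in M)%:R))).
  by apply: eq_bigr => z _; ring.
rewrite big_split !sumrB /= sumr_const -[al *+ _]mulr_natr -!mulr_sumr.
rewrite sum_coset sum_coset2.
under eq_bigr do rewrite -opprB local_ringN.
rewrite sum_coset -/m NE /al /be -/r -/m NE !exprS.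
by field.
Qed.

(** All diagonal entries of the power are equal, so the trace is |R| times one of them; |R| = |R^x|
    + |M| then cancels the denominator. *)
Lemma spectral_moment_local k :
  spectral_moment k.+1 (unitary_cayley R) =
  (nunits R)%:R * ((nunits R)%:R ^+ k - (- #|M|%:R) ^+ k).
Proof.
rewrite spectral_moment_kernel.
under eq_bigr do rewrite kernel_exp_local subrr.
have N0 : (nunits R)%:R + #|M|%:R != 0 :> algC.
  by rewrite -local_ring_card pnatr_eq0 -lt0n; apply/card_gt0P; exists 0.
have -> : 0 \in M by rewrite local_ring_nonunits unitr0.
rewrite sumr_const -[LHS]mulr_natr -[X in _ * X]/(#|R|%:R) local_ring_card !exprS mulr1.
by field.
Qed.

End LocalRing.

(** * Traces of powers of products and of shifted matrices *)

(** Follows from (AB)^(k+1) = A (BA)^k B and cyclicity of the trace. At exponent 0 the traces would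
    be the sizes [m] and [n]. *)
Lemma mxtrace_exp_mulC (F : fieldType) m n (A : 'M[F]_(m, n)) (B : 'M[F]_(n, m)) k :
  \tr ((A *m B) ^+ k.+1) = \tr ((B *m A) ^+ k.+1).
Proof.
have -> : (A *m B) ^+ k.+1 = A *m (B *m A) ^+ k *m B.
  elim: k => [|k IHk]; first by rewrite expr1 expr0 mulmx1.
  by rewrite exprS IHk exprS -[_ * _]/(_ *m _) -[B *m A * _]/(_ *m _) !mulmxA.
by rewrite mxtrace_mulC mulmxA exprS.
Qed.

Lemma mxtrace_exp_shift (F : fieldType) n (A : 'M[F]_n) (c : F) k :
  \tr ((A + c%:M) ^+ k) = \sum_(j < k.+1) 'C(k, j)%:R * c ^+ (k - j) * \tr (A ^+ j).
Proof.
have cAc : GRing.comm c%:M A by rewrite /GRing.comm -[LHS]scalar_mxC.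
rewrite addrC exprDn_comm // linear_sum /=; apply: eq_bigr => j _.
have -> : (c%:M : 'M[F]_n) ^+ (k - j) = (c ^+ (k - j))%:M by rewrite -rmorphXn.
rewrite -[_%:M * _]/(_ *m _) mul_scalar_mx raddfMn /= mxtraceZ.
by rewrite -[LHS]mulr_natl mulrA.
Qed.

(** * Incidence matrices and line graphs of regular graphs *)

Section Incidence.
Variable G : sgraph.

Definition incidence_mx : 'M[algC]_(#|G|, #|line_graph G|) :=
  \matrix_(i, e) (enum_val i \in val (enum_val e : edge G))%:R.

Lemma edgeP (A : {set G}) :
  reflect (exists x y : G, adj x y /\ A = [set x; y]) (is_edge A).
Proof.
apply: (iffP existsP) => [[x /existsP[y /andP[xy /eqP->]]] | [x [y [xy ->]]]].
  by exists x, y.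
by exists x; apply/existsP; exists y; rewrite xy eqxx.
Qed.

Lemma adj_neq (x y : G) : adj x y -> x != y.
Proof. by apply: contraTneq => ->; rewrite adj_irr. Qed.

Lemma card_edge (A : {set G}) : is_edge A -> #|A| = 2.
Proof. by case/edgeP=> x [y [/adj_neq xy ->]]; rewrite cards2 xy. Qed.

Lemma edge_adj (x y : G) : x != y -> is_edge [set x; y] = adj x y.
Proof.
move=> xy; apply/edgeP/idP => [[u [v [uv /setP eqxy]]] | axy]; last by exists x, y.
move: (eqxy x) (eqxy y) xy; rewrite !inE !eqxx orbT /=.
by case/esym/orP=> /eqP-> /esym/orP[]/eqP->; rewrite ?eqxx // adj_sym.
Qed.

Lemma edge_of_mem2 (A : {set G}) x y :
  is_edge A -> x != y -> x \in A -> y \in A -> A = [set x; y].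
Proof.
move=> eA xy Ax Ay; apply/esym/eqP; rewrite eqEcard (card_edge eA) cards2 xy.
by rewrite andbT; apply/subsetP=> z /set2P[]->.
Qed.

Lemma sum_edge (F : {set G} -> algC) :
  \sum_(e : edge G) F (val e) = \sum_(A : {set G} | is_edge A) F A.
Proof. by rewrite (big_sub (@is_edge G : {pred {set G}})). Qed.

(** Sending a neighbour y of [x] to {x, y} is a bijection onto the edges through [x]. *)
Lemma sum_edge_mem (x : G) :
  \sum_(A : {set G} | is_edge A) (x \in A)%:R = #|[set y | adj x y]|%:R :> algC.
Proof.
rewrite -natr_sum -big_mkcondr sum1dep_card; congr _%:R.
have inj_x : {in [set y | adj x y] &, injective (fun y => [set x; y])}.
  move=> y z; rewrite !inE => /adj_neq xy _ /setP/(_ y).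
  by rewrite !inE eqxx orbT eq_sym (negPf xy) => /esym/eqP.
rewrite -(card_in_imset inj_x); apply: eq_card => A.
rewrite inE; apply/andP/imsetP => [[eA Ax] | [y]]; last first.
  rewrite inE => axy ->; rewrite edge_adj ?adj_neq // axy.
  by rewrite !inE eqxx.
have [u [v [uv defA]]] := edgeP _ eA; move: Ax; rewrite defA => /set2P[]->.
  by exists v; rewrite ?inE.
by exists u; rewrite ?inE 1?adj_sym // setUC.
Qed.

(** The (x, y) entry counts the edges containing both x and y: the degree if x = y, otherwise 1 or 0
    according to adjacency. *)
Lemma incidence_mulT r : (forall x : G, #|[set y | adj x y]| = r) ->
  incidence_mx *m incidence_mx^T = adjmx G + (r%:R)%:M.
Proof.
move=> reg; apply/matrixP=> i j; rewrite !mxE.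
set x := enum_val i; set y := enum_val j.
transitivity (\sum_(A : {set G} | is_edge A) (x \in A)%:R * (y \in A)%:R : algC).
  rewrite -sum_edge (big_enum_val (fun e : edge G => _ * _)).
  by apply: eq_bigr => e _; rewrite !mxE.
have [eq_ij | neq_ij] := eqVneq i j.
  rewrite /x eq_ij -/y adj_irr add0r mulr1n -(reg y) -sum_edge_mem.
  by apply: eq_bigr => A _; rewrite -natrM mulnb andbb.
have xy : x != y by rewrite (inj_eq enum_val_inj).
rewrite mulr0n addr0; under eq_bigr do rewrite -natrM mulnb.
rewrite -natr_sum -big_mkcondr sum1dep_card; congr _%:R.
rewrite -(edge_adj xy); case: (boolP (is_edge _)) => [exy | nexy].
  apply/eqP/cards1P; exists [set x; y]; apply/setP=> A; rewrite !inE.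
  apply/and3P/eqP => [[eA Ax Ay] | ->]; last by rewrite !inE !eqxx orbT.
  exact: edge_of_mem2.
apply/eqP; rewrite cards_eq0; apply/eqP/setP=> A; rewrite !inE.
apply: contraNF nexy => /and3P[eA Ax Ay].
by rewrite -(edge_of_mem2 eA xy Ax Ay).
Qed.

(** The (A, B) entry is the size of the intersection of the edges A and B: 2 if they are equal,
    otherwise at most 1. *)
Lemma incidence_Tmul :
  incidence_mx^T *m incidence_mx = adjmx (line_graph G) + 2%:M.
Proof.
apply/matrixP=> i j; rewrite !mxE.
set A := enum_val i : edge G; set B := enum_val j : edge G.
transitivity (#|val A :&: val B|%:R : algC).
  rewrite -sum1_card natr_sum [RHS]big_mkcond.
  rewrite (big_enum_val (fun x : G => if x \in val A :&: val B then 1 else 0)).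
  apply: eq_bigr => k _; rewrite !mxE inE -natrM mulnb.
  by case: (_ && _).
have [eq_ij | neq_ij] := eqVneq i j.
  have -> : A = B by rewrite /A eq_ij.
  by rewrite setIid card_edge ?(valP B) // /= /line_adj eqxx add0r.
have AB : A != B by rewrite (inj_eq enum_val_inj).
rewrite mulr0n addr0 /= /line_adj AB /= -card_gt0; congr _%:R.
case: ltnP => [I0 | ]; last by rewrite leqn0 => /eqP.
(* Two common vertices would fill both edges and force [A] = [B]. *)
apply/eqP; rewrite eqn_leq I0 andbT leqNgt; apply: contra AB => I2.
have eqI (C : edge G) : val A :&: val B \subset val C -> val A :&: val B = val C.
  by move=> sub; apply/eqP; rewrite eqEcard sub card_edge ?(valP C).
by rewrite -val_eqE -(eqI A) ?subsetIl // (eqI B) ?subsetIr.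
Qed.

Lemma spectral_moment_line_graph r k : (forall x : G, #|[set y | adj x y]| = r) ->
  spectral_moment k.+1 (line_graph G) =
    \sum_(j < k.+2) 'C(k.+1, j)%:R * (r%:R - 2) ^+ (k.+1 - j) * spectral_moment j G
    - (- 2) ^+ k * #|G|%:R * (r%:R - 2).
Proof.
move=> reg; set B := incidence_mx.
have AE : adjmx G + (r%:R - 2)%:M = B *m B^T + (- 2)%:M.
  by rewrite (incidence_mulT reg) -addrA -raddfD.
have LE : adjmx (line_graph G) = B^T *m B + (- 2)%:M.
  by rewrite incidence_Tmul -addrA -raddfD /= subrr raddf0 addr0.
(* The handshake identity, from the equal traces of B B^T and B^T B, since adjacency matrices have
   trace 0. *)
have card_edges : 2 * #|line_graph G|%:R = #|G|%:R * r%:R :> algC.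
  have := mxtrace_mulC B B^T.
  rewrite (incidence_mulT reg) incidence_Tmul !mxtraceD !mxtrace_scalar.
  have tr0 H : \tr (adjmx H) = 0.
    by rewrite /mxtrace big1 // => i _; rewrite mxE adj_irr.
  rewrite !tr0 !add0r => trE.
  by rewrite [RHS]mulrC [RHS]mulr_natr trE [LHS]mulr_natr.
under eq_bigr do rewrite spectral_moment_trace.
rewrite -mxtrace_exp_shift AE spectral_moment_trace LE !mxtrace_exp_shift.
(* The two expansions differ only at j = 0, where the traces are |G| and the number of edges. The
   difference (-2)^(k+1) (|G| - |E|) is the correction term, by [card_edges]. *)
rewrite !(big_ord_recl k.+1) /=.
under eq_bigr do rewrite (mxtrace_exp_mulC B^T B).
rewrite !expr0 !mxtrace1 bin0 !subn0 !mul1r !exprS.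
rewrite -[X in _ = _ - X]mulrA (mulrBr #|G|%:R) -card_edges.
by ring.
Qed.

End Incidence.

(** * The two moment formulas *)

(** The involution y -> x - y exchanges the neighbours of [x] and the units. *)
Lemma unitary_cayley_regular (R : finComUnitRingType) (x : unitary_cayley R) :
  #|[set y | adj x y]| = nunits R.
Proof.
rewrite /nunits [RHS]cardsT card_sub -(card_imset _ (inv_inj (subKr x))).
apply: eq_card => y; rewrite [RHS]inE; apply/imsetP/idP => [[z] | Uy].
  by rewrite inE => + ->.
by exists (x - y); rewrite ?inE /= /unitary_adj subKr.
Qed.

Theorem theorem6p1 (n : nat) (Rs : 'I_n.+1 -> finComUnitRingType)
    (M : forall i : 'I_n.+1, {set Rs i})
    (hloc : forall i : 'I_n.+1, local_ring_with (M i))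
    (hord : forall i j : 'I_n.+1, (i <= j)%N ->
       #|Rs i|%:R / #|M i|%:R <= #|Rs j|%:R / #|M j|%:R :> rat)
    (k : nat) (hk : (0 < k)%N) :
  let R : finComUnitRingType := prod_ring Rs in
  let G : sgraph := unitary_cayley R in
  spectral_moment k G =
    (nunits R)%:R *
    \prod_(i < n.+1) ((nunits (Rs i))%:R ^+ (k - 1) - (- #|M i|%:R) ^+ (k - 1))
  /\
  spectral_moment k (line_graph G) =
    \sum_(0 <= j < k.+1)
      'C(k, j)%:R * ((nunits R)%:R - 2) ^+ (k - j) * spectral_moment j G
    - (- 2) ^+ (k - 1) * #|R|%:R * ((nunits R)%:R - 2).
Proof.
move=> R G; case: k hk => // k _; rewrite subn1 /=; split.
  (* Each local factor contributes its own number of units, and these multiply to the number of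
     units of [R]. *)
  rewrite spectral_moment_prod_ring nunits_prod_ring -big_split.
  by apply: eq_bigr => i _; rewrite (spectral_moment_local (hloc i)).
rewrite big_mkord; apply: spectral_moment_line_graph.
exact: unitary_cayley_regular.
Qed.
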